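(* Let $p$ be a prime and $N_p=\frac{p^p-1}{p-1}$. For all integers $n,k\geq 0$, $$A_{n+N_p+k,\,k}\equiv A_{n+k,k}\pmod p\qquad\text{and}\qquad A_{n+N_p+k,\,N_p+k}\equiv A_{n+k,k}\pmod p.$$ That is, the sequences $(A_{n+k,k})_{n\geq 0}$ (for fixed $k$) and $(A_{n+k,k})_{k\geq 0}$ (for fixed $n$) are both periodic modulo $p$ with period $N_p$.
   Context: A partition of a finite set is a collection of nonempty, pairwise disjoint subsets (blocks) whose union is the set; a singleton of a partition is a block with exactly one element. For integers $0\leq k\leq n$, $A_{n,k}$ denotes the number of partitions of $\{1,2,\dots,n+1\}$ whose largest singleton is $k+1$ (i.e. $\{k+1\}$ is a block and no $j>k+1$ forms a singleton block). *)

(* Defs.v *)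
From mathcomp Require Import all_boot.

Set Implicit Arguments.
Unset Strict Implicit.
Unset Printing Implicit Defensive.

(* The ground set {1, ..., n+1} is 'I_n.+1, the element j+1 being the ordinal  *)
(* of value j.                                                                *)
Definition largest_singleton (n : nat) (P : {set {set 'I_n.+1}})
    (i : 'I_n.+1) : bool :=
  ([set i] \in P) && [forall j : 'I_n.+1, (i < j) ==> ([set j] \notin P)].

(* A_{n,k}; junk value 0 when k > n. *)
Definition A (n k : nat) : nat :=
  #|[set P : {set {set 'I_n.+1}} | partition P [set: 'I_n.+1]
      & [exists i : 'I_n.+1, (i == k :> nat) && largest_singleton P i]]|.

(* The division is exact, p - 1 being a divisor of p ^ p - 1. *)
Definition Np (p : nat) : nat := (p ^ p - 1) %/ (p - 1).

(* Main.v *)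
(* Deleting the largest singleton shows that A_{n+k,k} counts the partitions  *)
(* of an (n+k)-set none of whose singletons lies in a prescribed n-subset.    *)
(* Let L be the linear functional on polynomials sending X^m to the Bell      *)
(* number B_m; inclusion-exclusion gives A_{n+k,k} = L(X^k (X-1)^n). The Bell *)
(* recurrence reads L(X f) = L(f(X+1)), hence                                 *)
(* L(X(X-1)...(X-m+1) f) = L(f(X+m)); for m = p and modulo p this becomes     *)
(* L((X^p - X) f) = L(f), that is, L kills the ideal generated by             *)
(* X^p - X - 1. Modulo this ideal, y = X and y = X - 1 satisfy y^p = y + 1,   *)
(* so y^(p^i) = y + i and y^(N_p) = prod_(i < p) (y + i) = y^p - y = 1.       *)
Require Import Defs.
From HB Require Import structures.
From mathcomp Require Import all_boot all_algebra all_field.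

Set Implicit Arguments.
Unset Strict Implicit.
Unset Printing Implicit Defensive.

(** Since [A_umbra] writes A_{n+k,k} as the value of a linear functional at X^k (X-1)^n, raising n
    by N_p inserts a factor (X-1)^{N_p} and raising k by N_p inserts X^{N_p}. Both factors act as 1
    over F_p. The combinatorial input is [nosingU1], which gives the factor X - 1, and
    [bell_set_rec], which gives the shift rule [umbra_mulX]. The arithmetic input is [umbra_eqXp],
    that is X^p = X + 1, from which [umbra_eq_expNp] derives y^{N_p} = 1 by Frobenius. *)

Section SetPartitions.

Variable T : finType.
Implicit Types (B C D M : {set T}) (P : {set {set T}}).
Implicit Types phi : pred {set {set T}}.

(** Removing the block [B] is a bijection with inverse [P] to [B |: P]. As [B] is nonempty, it is
    never a block of a partition of [D :\: B], so adding it loses nothing. *)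
Lemma card_partition_with_block D B phi : B != set0 -> B \subset D ->
  #|[set P | partition P D & (B \in P) && phi P]| =
  #|[set P | partition P (D :\: B) & phi (B |: P)]|.
Proof.
move=> B_neq0 sBD.
have notB P : partition P (D :\: B) -> B \notin P.
  move=> partP; apply/negP => BP; have sB : {subset B <= D :\: B}.
    by move=> y yB; rewrite -(cover_partition partP); apply/bigcupP; exists B.
  have /set0Pn[x xB] := B_neq0.
  by have := sB x xB; rewrite inE xB.
rewrite -[RHS](@card_in_imset _ _ (fun P => B |: P)) => [|P Q].
  apply: eq_card => P; rewrite !inE; apply/and3P/imsetP => [[partP BP phiP]|].
    by exists (P :\ B); rewrite ?inE ?setD1K // partitionD1.
  case=> Q; rewrite !inE => /andP[partQ phiQ] ->; split=> //; last first.
    by rewrite !inE eqxx.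
  rewrite -(setID D B) (setIidPr sBD) partitionU1 //.
  by rewrite disjoints_subset setDE setCI setCK subsetUr.
rewrite !inE => /andP[/notB BP _] /andP[/notB BQ _] eqPQ.
by rewrite -(setU1K BP) eqPQ setU1K.
Qed.

Definition bell_set D := #|[set P | partition P D]|.

Lemma bell_set0 : bell_set set0 = 1.
Proof.
rewrite /bell_set (_ : [set P | _] = [set set0]) ?cards1 //.
by apply/setP => P; rewrite !inE partition_set0.
Qed.

(** Sort the partitions by the complement [C] of the block of [x]: the other blocks form an
    arbitrary partition of [C]. *)
Lemma bell_set_rec D x : x \in D ->
  bell_set D = \sum_(C in powerset (D :\ x)) bell_set C.
Proof.
move=> xD.
have blockP P : partition P D -> pblock P x \subset D /\ x \in pblock P x.
  move=> partP; have covP := cover_partition partP.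
  rewrite mem_pblock covP xD; split=> //.
  by rewrite -covP (bigcup_max (pblock P x)) ?pblock_mem ?covP.
rewrite /bell_set -sum1_card.
rewrite (partition_big (fun P => D :\: pblock P x) (mem (powerset (D :\ x)))) /=;
  last first.
  by move=> P; rewrite !inE => /blockP[_ xP]; rewrite setDS // sub1set.
apply: eq_bigr => C; rewrite inE subsetD1 => /andP[sCD xC].
have xDC : x \in D :\: C by rewrite inE xC.
have DC0 : D :\: C != set0 by apply/set0Pn; exists x.
have DDC : D :\: (D :\: C) = C by rewrite setDDr setDv set0U (setIidPr sCD).
rewrite sum1dep_card -[in RHS]DDC.
transitivity #|[set P | partition P D & (D :\: C \in P) && predT P]|.
  apply: eq_card => P; rewrite !inE andbT.
  apply: andb_id2l => partP; have [sPD xP] := blockP _ partP.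
  have covP := cover_partition partP.
  apply/eqP/idP => [<-|DCP].
    by rewrite setDDr setDv set0U (setIidPr sPD) pblock_mem ?covP.
  by rewrite (def_pblock (partition_trivIset partP) DCP xDC).
rewrite card_partition_with_block ?subsetDl //.
by apply: eq_card => P; rewrite !inE andbT.
Qed.

Lemma sum_powerset_card D (f : nat -> nat) :
  \sum_(C in powerset D) f #|C| = \sum_(i < #|D|.+1) 'C(#|D|, i) * f i.
Proof.
rewrite (partition_big (fun C : {set T} => inord #|C| : 'I_#|D|.+1) predT) //=.
apply: eq_bigr => i _; rewrite -cards_draws -sum_nat_const.
apply: eq_big => [C|C]; rewrite !inE.
  apply: andb_id2l => sCD; have := subset_leq_card sCD => leCD.
  by rewrite -val_eqE /= inordK.
by case/andP=> sCD /eqP<-; rewrite inordK // ltnS subset_leq_card.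
Qed.

(** * Partitions with forbidden singletons *)

Definition nosing M D :=
  #|[set P | partition P D & [forall x in M, [set x] \notin P]]|.

Lemma nosing0 D : nosing set0 D = bell_set D.
Proof.
apply: eq_card => P; rewrite !inE; case: partition => //=.
by apply/forall_inP => x; rewrite inE.
Qed.

Lemma card_singleton_nosing M D x : x \in D -> x \notin M ->
  #|[set P | partition P D & ([set x] \in P) &&
       [forall y in M, [set y] \notin P]]| = nosing M (D :\ x).
Proof.
move=> xD xM.
rewrite (card_partition_with_block (fun P => [forall y in M, [set y] \notin P])).
- apply: eq_card => P; rewrite !inE; congr (_ && _).
  apply: eq_forallb => y; have [yM|//] := boolP (y \in M).
  rewrite !inE (inj_eq set1_inj) (negbTE _ : y == x = false) //.
  by apply: contraNneq xM => <-.
- by apply/set0Pn; exists x; rewrite set11.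
- by rewrite sub1set.
Qed.

(** Split according to whether [[set x]] is a block. This is one step of the inclusion-exclusion
    over forbidden singletons. *)
Lemma nosingU1 M D x : x \in D -> x \notin M ->
  nosing M D = nosing (x |: M) D + nosing M (D :\ x).
Proof.
move=> xD xM; rewrite -card_singleton_nosing //.
rewrite -[LHS](cardsID [set P : {set {set T}} | [set x] \notin P]); congr (_ + _).
  apply: eq_card => P; rewrite !inE -andbA; congr (_ && _).
  apply/andP/forall_inP => [[/forall_inP nsM nsx] y|ns].
    by rewrite !inE => /orP[/eqP->|/nsM].
  by split; [apply/forall_inP => y yM|]; apply: ns; rewrite !inE ?yM ?orbT ?eqxx.
by apply: eq_card => P; rewrite !inE negbK andbCA.
Qed.

End SetPartitions.

(** * Bell numbers and their recurrence *)

Definition bell m := bell_set [set: 'I_m].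

(** A joint strong induction: [bell_set_rec] expresses the count through smaller sets, so dependence
    on cardinality alone propagates without transporting partitions along bijections. *)
Lemma bell_setE_rec m :
  (forall (T : finType) (D : {set T}), #|D| = m -> bell_set D = bell m) /\
  bell m.+1 = \sum_(i < m.+1) 'C(m, i) * bell i.
Proof.
elim/ltn_ind: m => m IHm.
have IHr (T : finType) (D : {set T}) n : n <= m ->
    (forall i, i <= n ->
       forall (U : finType) (C : {set U}), #|C| = i -> bell_set C = bell i) ->
    #|D| = n.+1 -> bell_set D = \sum_(i < n.+1) 'C(n, i) * bell i.
  move=> le_nm bellE cardD.
  have /card_gt0P[x xD] : 0 < #|D| by rewrite cardD.
  have cardDx : #|D :\ x| = n by have := cardsD1 x D; rewrite xD cardD => -[].
  have := sum_powerset_card (D :\ x) bell; rewrite cardDx => <-.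
  rewrite (bell_set_rec xD).
  apply: eq_bigr => C; rewrite inE => sCD; apply: bellE => //.
  by rewrite -cardDx subset_leq_card.
have bellE (T : finType) (D : {set T}) : #|D| = m -> bell_set D = bell m.
  case: m IHm IHr => [|m] IHm IHr cardD.
    have ->: D = set0 by apply/eqP; rewrite -cards_eq0 cardD.
    rewrite /bell (_ : setT = set0) ?bell_set0 //.
    by apply/setP => -[].
  by rewrite /bell !(@IHr _ _ m) ?cardsT ?card_ord // => i lim; case: (IHm i).
split=> //; apply: (IHr _ _ m) => //; last by rewrite cardsT card_ord.
by move=> i; rewrite leq_eqVlt => /orP[/eqP->//|/IHm[]].
Qed.

Lemma bell_setE (T : finType) (D : {set T}) : bell_set D = bell #|D|.
Proof. by case: (bell_setE_rec #|D|) => ->. Qed.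

Lemma bellS m : bell m.+1 = \sum_(i < m.+1) 'C(m, i) * bell i.
Proof. by case: (bell_setE_rec m). Qed.

(** Delete the block of the ordinal of value [k]; the [n] ordinals above it are the forbidden
    singletons. *)
Lemma A_nosing n k : exists T : finType, exists D M : {set T},
  [/\ M \subset D, #|D| = n + k, #|M| = n & A (n + k) k = nosing M D].
Proof.
have ltk : k < (n + k).+1 by rewrite ltnS leq_addl.
pose i := Ordinal ltk.
pose M := [set j : 'I_(n + k).+1 | i < j].
have iM : i \notin M by rewrite inE ltnn.
exists 'I_(n + k).+1, [set~ i], M; split.
- apply/subsetP => j; rewrite !inE => ltij.
  by apply: contraTneq ltij => ->; rewrite ltnn.
- by rewrite cardsC1 card_ord.
(* The complement of [M] consists of the ordinals at most [k], a copy of ['I_k.+1]. *)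
- have: #|~: M| = k.+1.
    have winj : injective (widen_ord ltk).
      by move=> a b /(congr1 val) /= /val_inj.
    rewrite -[RHS]card_ord -(card_imset _ winj).
    apply: eq_card => j; rewrite !inE -leqNgt; apply/idP/imsetP => [lejk|[l _ ->]].
      by exists (Ordinal (lejk : j < k.+1)) => //; apply: val_inj.
    by rewrite /= -ltnS.
  have := cardsC M; rewrite card_ord => /[swap] -> /eqP.
  by rewrite addnS eqSS eqn_add2r => /eqP.
rewrite -setTD -card_singleton_nosing ?in_setT //.
apply: eq_card => P; rewrite !inE; congr (_ && _).
apply/existsP/andP => [[j /andP[/eqP eqjk]]|[iP nsM]].
  have ->: j = i by apply: val_inj.
  case/andP=> iP /forall_inP nsM; split=> //.
  by apply/forall_inP => l; rewrite inE; apply: nsM.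
exists i; rewrite eqxx /= /largest_singleton iP /=.
by apply/forall_inP => l ltil; apply: (forall_inP nsM); rewrite inE.
Qed.

Import GRing.Theory.

(** * The umbral functional sending X^m to the Bell number B_m *)

Section Umbra.

Local Open Scope ring_scope.
Variable R : comNzRingType.
Implicit Types (f g u v : {poly R}).

Definition umbra f : R := \sum_(i < size f) f`_i * (bell i)%:R.

Lemma umbraE n f : (size f <= n)%N ->
  umbra f = \sum_(i < n) f`_i * (bell i)%:R.
Proof.
move=> le_fn; rewrite /umbra (big_ord_widen n (fun i => f`_i * (bell i)%:R)) //.
rewrite big_mkcond; apply: eq_bigr => i _; case: ltnP => // lefi.
by rewrite nth_default ?mul0r.
Qed.

Fact umbra_is_scalar : scalar umbra.
Proof.
move=> a f g; pose n := maxn (size f) (size g).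
have len : (size (a *: f + g)%R <= n)%N.
  rewrite (leq_trans (size_polyD _ _)) // geq_max leq_maxr andbT.
  by rewrite (leq_trans (size_scale_leq _ _)) // leq_maxl.
rewrite (umbraE len) (@umbraE n f) ?leq_maxl // (@umbraE n g) ?leq_maxr //.
rewrite mulr_sumr -big_split; apply: eq_bigr => i _ /=.
by rewrite coefD coefZ mulrDl mulrA.
Qed.

HB.instance Definition _ :=
  GRing.isLinear.Build R {poly R} R *%R umbra umbra_is_scalar.

Lemma umbraXn m : umbra 'X^m = (bell m)%:R.
Proof.
rewrite /umbra size_polyXn big_ord_recr /= big1 ?add0r => [|i _].
  by rewrite coefXn eqxx mul1r.
by rewrite coefXn ltn_eqF ?mul0r.
Qed.

(** By linearity it suffices to take f = X^i, where this is the Bell recurrence read through the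
    binomial expansion of (X+1)^i. *)
Lemma umbra_mulX f : umbra ('X * f) = umbra (f \Po ('X + 1)).
Proof.
rewrite comp_polyE linear_sum -[f in 'X * f]coefK poly_def mulr_sumr linear_sum.
apply: eq_bigr => i _; rewrite -scalerAr !linearZ /=; congr (_ * _).
rewrite -exprS umbraXn bellS natr_sum addrC exprDn linear_sum.
apply: eq_bigr => j _; rewrite expr1n mul1r raddfMn /= umbraXn.
by rewrite natrM mulr_natl.
Qed.

(** The shift by [m] turns the last factor X - m into X, which [umbra_mulX] trades for one more
    shift. *)
Lemma umbra_falling m f :
  umbra (\prod_(i < m) ('X - i%:R) * f) = umbra (f \Po ('X + m%:R)).
Proof.
elim: m f => [|m IHm] f; first by rewrite big_ord0 mul1r addr0 comp_polyXr.
rewrite big_ord_recr /= -mulrA IHm comp_polyM comp_polyB comp_polyX.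
rewrite -polyC_natr comp_polyC addrK umbra_mulX -comp_polyA.
by rewrite comp_polyD comp_polyX comp_polyC -addrA polyC_natr nat1r.
Qed.

(* Congruence modulo the largest ideal contained in the kernel of umbra. *)
Definition umbra_eq u v := forall f, umbra (u * f) = umbra (v * f).

(** The functional is not multiplicative, but the test polynomial [f] is arbitrary and can absorb
    the other factor. *)
Lemma umbra_eq_mul u1 v1 u2 v2 :
  umbra_eq u1 v1 -> umbra_eq u2 v2 -> umbra_eq (u1 * u2) (v1 * v2).
Proof. by move=> eq1 eq2 f; rewrite -mulrA eq1 mulrCA eq2 mulrCA mulrA. Qed.

Lemma umbra_eq_exp u v m : umbra_eq u v -> umbra_eq (u ^+ m) (v ^+ m).
Proof.
move=> equv; elim: m => [|m IHm]; first by [].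
by rewrite !exprS; apply: umbra_eq_mul.
Qed.

Lemma umbra_eq_add u1 v1 u2 v2 :
  umbra_eq u1 v1 -> umbra_eq u2 v2 -> umbra_eq (u1 + u2) (v1 + v2).
Proof. by move=> eq1 eq2 f; rewrite !mulrDl !linearD /= eq1 eq2. Qed.

(** Induction on #|M|: by [nosingU1], forbidding one more singleton subtracts the count with that
    point deleted, which replaces one factor X by X - 1. *)
Lemma nosing_umbra (T : finType) (D M : {set T}) : M \subset D ->
  (nosing M D)%:R = umbra ('X^(#|D| - #|M|) * ('X - 1) ^+ #|M|).
Proof.
move: {2}#|M| (erefl #|M|) => m.
elim: m M D => [|m IHm] M D cardM sMD.
  have M0 : M = set0 by apply/eqP; rewrite -cards_eq0 cardM.
  by rewrite M0 cards0 subn0 expr0 mulr1 umbraXn nosing0 bell_setE.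
have /card_gt0P[x xM] : (0 < #|M|)%N by rewrite cardM.
have xD := subsetP sMD x xM.
have cardMx : #|M :\ x| = m by have := cardsD1 x M; rewrite xM cardM => -[].
have cardDx : #|D| = #|D :\ x|.+1 by rewrite (cardsD1 x D) xD.
have sMDx : M :\ x \subset D :\ x by rewrite setSD.
have leM : (m <= #|D :\ x|)%N by rewrite -cardMx subset_leq_card.
have xMx : x \notin M :\ x by rewrite !inE eqxx.
have := nosingU1 xD xMx; rewrite setD1K // => /(congr1 (fun i => i%:R : R)).
rewrite natrD (IHm _ D cardMx) ?(subset_trans (subD1set _ _) sMD) //.
rewrite (IHm _ _ cardMx sMDx) cardMx.
move/eqP; rewrite -subr_eq => /eqP <-.
rewrite -linearB /= cardM cardDx subSS subSn // -mulrBl exprSr exprS.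
by rewrite -[X in _ - X]mulr1 -mulrBr mulrA.
Qed.

End Umbra.

Lemma A_umbra (R : comNzRingType) n k :
  ((A (n + k) k)%:R = umbra ('X^k * ('X - 1) ^+ n : {poly R}))%R.
Proof.
have [T [D [M [sMD cardD cardM ->]]]] := A_nosing n k.
by rewrite (nosing_umbra R sMD) cardD cardM addKn.
Qed.

Lemma Np_sum p : 1 < p -> Np p = \sum_(i < p) p ^ i.
Proof.
by move=> p_gt1; rewrite /Np !subn1 predn_exp mulKn // -subn1 subn_gt0.
Qed.

(** * Reduction modulo p *)

Section PrimeField.

Local Open Scope ring_scope.
Variable p : nat.
Hypothesis p_prime : prime p.
Implicit Types f y : {poly 'F_p}.

Let pcharXp : p \in [pchar {poly 'F_p}].
Proof. by rewrite pchar_poly pchar_Fp. Qed.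

Lemma Fp_nat_inj : injective (fun i : 'I_p => i%:R : 'F_p).
Proof.
move=> i j /(congr1 val); rewrite /= !val_Fp_nat // !modn_small // => eq_ij.
exact: val_inj.
Qed.

(** An injective [h] enumerates F_p, so this is the factorization of X^p - X evaluated at [y]. It
    serves for both enumerations i and -i. *)
Lemma prod_subC_Fp (h : 'I_p -> 'F_p) y : injective h ->
  \prod_(i < p) (y - (h i)%:P) = y ^+ p - y.
Proof.
move=> injh; have := finField_genPoly 'F_p; rewrite card_Fp //.
have bijh : bijective h by apply: inj_card_bij => //; rewrite card_Fp ?card_ord.
rewrite (reindex h (onW_bij _ bijh)) /=.
move/(congr1 (comp_poly y)); rewrite rmorph_prod rmorphB rmorphXn /= comp_polyX.
by move=> ->; apply: eq_bigr => i _; rewrite comp_polyB comp_polyX comp_polyC.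
Qed.

Lemma prod_subn_Fp y : \prod_(i < p) (y - i%:R) = y ^+ p - y.
Proof.
rewrite -(prod_subC_Fp y Fp_nat_inj).
by apply: eq_bigr => i _; rewrite polyC_natr.
Qed.

Lemma prod_addn_Fp y : \prod_(i < p) (y + i%:R) = y ^+ p - y.
Proof.
rewrite -(prod_subC_Fp y (inj_comp oppr_inj Fp_nat_inj)).
by apply: eq_bigr => i _; rewrite /= polyCN opprK polyC_natr.
Qed.

Lemma umbra_eqXp : umbra_eq 'X^p ('X + 1 : {poly 'F_p}).
Proof.
move=> f; apply/eqP; rewrite mulrDl mul1r linearD addrC -subr_eq -linearB /=.
rewrite -mulrBl -prod_subn_Fp umbra_falling.
by rewrite (pcharf0 pcharXp) addr0 comp_polyXr.
Qed.

(** Stated for general [y] so as to apply to both X and X - 1. *)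
Lemma umbra_eq_expNp y : umbra_eq (y ^+ p) (y + 1) -> umbra_eq (y ^+ Np p) 1.
Proof.
move=> yp.
have ypi i : umbra_eq (y ^+ (p ^ i)) (y + i%:R).
  elim: i => [|i IHi]; first by rewrite expn0 addr0.
  move=> f; rewrite expnSr exprM (umbra_eq_exp p IHi).
  (* Frobenius is additive and fixes the constant i, so (y + i)^p = y^p + i. *)
  rewrite -[_ ^+ p]/(pFrobenius_aut pcharXp _) rmorphD /= pFrobenius_aut_nat.
  rewrite pFrobenius_autE (umbra_eq_add yp (fun f => erefl)).
  by rewrite -addrA nat1r.
have yN : umbra_eq (y ^+ Np p) (\prod_(i < p) (y + i%:R)).
  rewrite Np_sum ?prime_gt1 // expr_sum.
  by apply: big_ind2 => //; apply: umbra_eq_mul.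
move=> f; rewrite yN prod_addn_Fp.
by rewrite (umbra_eq_add yp (fun f => erefl)) addrAC subrr add0r.
Qed.

End PrimeField.

Theorem theorem4p4 (p : nat) (p_prime : prime p) (n k : nat) :
  A (n + Np p + k) k = A (n + k) k %[mod p] /\
  A (n + Np p + k) (Np p + k) = A (n + k) k %[mod p].
Proof.
have modE a b : (a%:R = b%:R :> 'F_p)%R -> a = b %[mod p].
  by move/(congr1 val); rewrite /= !val_Fp_nat.
have XN := umbra_eq_expNp p_prime (umbra_eqXp p_prime).
have X1N : umbra_eq (('X - 1) ^+ Np p) (1 : {poly 'F_p})%R.
  apply: umbra_eq_expNp => //.
  have pcharXp : p \in [pchar {poly 'F_p}]%R by rewrite pchar_poly pchar_Fp.
  (* Here (X - 1)^p = X^p - 1, which is congruent to (X + 1) - 1 = (X - 1) + 1. *)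
  rewrite -[(_ ^+ p)%R]/(pFrobenius_aut pcharXp _) rmorphB rmorph1 /=.
  rewrite [in X in umbra_eq _ X]addrAC.
  by apply: umbra_eq_add => //; rewrite pFrobenius_autE; apply: umbra_eqXp.
split; apply: modE.
  by rewrite !A_umbra exprD mulrA mulrC X1N mul1r.
(* Reassociating lets [Np p + k] take the place of [k], so the extra factor is X^{N_p}. *)
rewrite -addnA A_umbra A_umbra exprD -mulrA.
by rewrite XN mul1r.
Qed.
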